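(* Let $\theta\in(0,1)$, $c>0$, and suppose the urn probabilities satisfy $$p_i=c\,i^{-1/\theta}\bigl(1+o(i^{-1/2})\bigr)\quad\text{as } i\to\infty.$$ Then, as $n\to\infty$, $$\frac{\mathbf{E} R_{n,1}-\theta\,\mathbf{E} R_n}{\sqrt{\alpha(n)}}\to0,$$ and, for every integer $k\ge1$, $$\frac{(k-\theta)\,\mathbf{E} R_{n,k}-(k+1)\,\mathbf{E} R_{n,k+1}}{\sqrt{\alpha(n)}}\to0 .$$
   Context: Infinite urn scheme: there are infinitely many urns $i=1,2,\ldots$ with probabilities $p_1\ge p_2\ge\cdots>0$, $\sum_i p_i=1$. Each of $n$ balls is independently placed in urn $i$ with probability $p_i$. $J_i(n)$ is the number of balls in urn $i$ after $n$ balls. $R_n=\sum_{i\ge1}\mathbf{I}\{J_i(n)>0\}$ is the number of nonempty urns; $R_{n,k}=\sum_{i\ge1}\mathbf{I}\{J_i(n)=k\}$ is the number of urns with exactly $k$ balls. $\alpha(x)=\max\{j\mid p_j\ge1/x\}$ (equal to $0$ if there is no such $j$). *)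

(* Defs.v *)
From HB Require Import structures.
From mathcomp Require Import all_boot all_order all_algebra.
From mathcomp Require Import all_classical all_reals all_analysis.
Set Implicit Arguments.
Unset Strict Implicit.
Unset Printing Implicit Defensive.
Import Order.TTheory GRing.Theory Num.Theory.
Import numFieldNormedType.Exports.
Local Open Scope classical_set_scope.
Local Open Scope ring_scope.

(* Urns are numbered 1, 2, ...; the value [p 0] plays no role anywhere. *)
Definition urn_probabilities (R : realType) (p : nat -> R) : Prop :=
  [/\ forall i : nat, (1 <= i)%N -> 0 < p i,
      forall i j : nat, (1 <= i)%N -> (i <= j)%N -> p j <= p i
    & (\sum_(1 <= i <oo) (p i)%:E = 1)%E].

(* Mutual independence: the product rule over every finite set of indices. *)
Definition mutually_independent (d : measure_display) (T : measurableType d)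
    (R : realType) (P : probability T R) (d' : measure_display)
    (T' : measurableType d') (X : nat -> {RV P >-> T'}) : Prop :=
  forall (s : seq nat) (A : nat -> set T'), uniq s ->
    (forall j, measurable (A j)) ->
    P (\bigcap_(j in [set` s]) (X j @^-1` A j)) =
    (\prod_(j <- s) P (X j @^-1` A j))%E.

(* [X j w] is the urn receiving the ball number [j], balls being numbered
   0, 1, ...; the first [n] balls are those with [j < n]. Urn 0, which is not
   an urn, receives a ball with probability zero, as the [p i], i >= 1, sum
   to 1. *)
Definition urn_scheme (d : measure_display) (T : measurableType d)
    (R : realType) (P : probability T R) (p : nat -> R)
    (X : nat -> {RV P >-> nat}) : Prop :=
  mutually_independent X /\
  forall i j : nat, (1 <= i)%N -> P (X j @^-1` [set i]) = (p i)%:E.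

Definition nballs (T : Type) (X : nat -> T -> nat) (i n : nat) (w : T) : nat :=
  (\sum_(j < n) (X j w == i))%N.

(* At most [n] terms of each of the next two series are nonzero (for [k >= 1]
   in the second one), so [fine] does not alter their values. *)
Definition nonempty_urns (R : realType) (T : Type) (X : nat -> T -> nat)
    (n : nat) (w : T) : R :=
  fine (\sum_(1 <= i <oo) ((0 < nballs X i n w)%N%:R)%:E)%E.

Definition urns_with (R : realType) (T : Type) (X : nat -> T -> nat)
    (n k : nat) (w : T) : R :=
  fine (\sum_(1 <= i <oo) ((nballs X i n w == k)%:R)%:E)%E.

(* max {j >= 1 | p j >= 1 / x}, and 0 if this set has no greatest element
   (in particular if it is empty). *)
Definition alpha (R : realType) (p : nat -> R) (x : R) : nat :=
  xget 0%N [set m : nat | [/\ (1 <= m)%N, 1 / x <= p m &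
    forall j : nat, (1 <= j)%N -> 1 / x <= p j -> (j <= m)%N]].

(* Main.v *)
(* Let [b_k] be the binomial probability [C(n,k) x^k (1-x)^(n-k)], so that
   [E R_{n,k}] is the sum of [b_k(p_i)] and [E R_n] that of [1 - b_0(p_i)].
   Since [x b_k' = k b_k - (k+1) b_{k+1}], both quantities to be estimated are
   sums over the urns of [G(p_i)], with [G(x) = x F'(x) - theta F(x)] and
   [F = 1 - b_0] or [F = b_k].  For [q(x) = c x^(-1/theta)] the function
   [x F(q(x))] has derivative [- G(q(x)) / theta], so the sum of [G(q(y_i))],
   for suitable [y_i] in [(i, i+1)], telescopes to [O(1)].  Replacing [q(y_i)]
   by [p_i] costs [O(min(1, n q(i))) (|eps_i| + 1/i)], because [x G'(x)] is
   again a combination of binomial probabilities; as [|eps_i| + 1/i] is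
   [o(i^(-1/2))], these errors add up to [o(n^(theta/2))], and [alpha(n)] is at
   least of order [n^theta]. *)
Require Import Defs.
From HB Require Import structures.
From mathcomp Require Import all_boot all_order all_algebra.
From mathcomp Require Import all_classical all_reals all_analysis.
From mathcomp Require Import ring lra.
Set Implicit Arguments.
Unset Strict Implicit.
Unset Printing Implicit Defensive.
Import Order.TTheory GRing.Theory Num.Theory.
Import numFieldNormedType.Exports.
Local Open Scope classical_set_scope.
Local Open Scope ring_scope.

(** * Power sums *)

Lemma MVT_closed (R : realType) (f df : R -> R) (a b : R) : a < b ->
  (forall x, a <= x <= b -> is_derive x 1 f (df x)) ->
  exists2 x, a < x < b & f b - f a = df x * (b - a).
Proof.
move=> ab fd.
have [||x] := @MVT R f df a b ab.
- move=> x; rewrite in_itv/= => /andP[/ltW ax /ltW xb].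
  by apply: fd; rewrite ax.
- apply: derivable_within_continuous => x; rewrite in_itv/= => /fd fdx.
  exact: @ex_derive.
- by rewrite in_itv/= => xab ->; exists x.
Qed.

Lemma le_powRN (R : realType) (a x y : R) : 0 <= a -> 0 < x -> x <= y ->
  y `^ (- a) <= x `^ (- a).
Proof.
move=> a0 x0 xy; rewrite !powRN lef_pV2 ?posrE ?powR_gt0 ?(lt_le_trans x0)//.
by rewrite ge0_ler_powR// nnegrE ltW// (lt_le_trans x0).
Qed.

(** Comparison with the integral of [x^(-a)], done by the mean value theorem on [[i, i+1]]. The
    factor [2^a] pays for replacing the intermediate point, which is at most [2 i], by [i]. *)
Lemma sum_powRN_le (R : realType) (a : R) (N M : nat) : 1 < a -> (1 <= N)%N ->
  \sum_(N <= i < M) i%:R `^ (- a) <=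
  2 `^ a / (a - 1) * N%:R `^ (1 - a) :> R.
Proof.
move=> a1 N1; have [MN|/ltnW NM] := leqP M N.
  rewrite big_geq// mulr_ge0 ?powR_ge0// divr_ge0 ?powR_ge0// subr_ge0.
  exact: ltW.
have a0 : 0 < a by apply: lt_trans a1.
(* [h i] is [- 2^a] times the integral of [x^(-a)] over [[i, oo)]. *)
pose h (i : nat) : R := - (2 `^ a / (a - 1) * i%:R `^ (1 - a)).
apply: (@le_trans _ _ (\sum_(N <= i < M) (h i.+1 - h i))); last first.
  rewrite telescope_sumr// /h opprK addrC gerDl oppr_le0 mulr_ge0 ?powR_ge0//.
  by rewrite divr_ge0 ?powR_ge0// subr_ge0 ltW.
rewrite !big_nat; apply: ler_sum => i /andP[Ni _].
have i1 : 1 <= i%:R :> R by rewrite ler1n (leq_trans N1).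
have i0 : 0 < i%:R :> R by apply: lt_le_trans i1.
have [||x /andP[ix xi] /=] := @MVT_closed R (fun x => x `^ (1 - a))
    (fun x => (1 - a) * x `^ (1 - a - 1)) i%:R i.+1%:R.
- by rewrite ltr_nat.
- move=> x /andP[ix _]; apply: is_derive1_powR.
  exact: lt_le_trans ix.
rewrite -(natr1 i) [i%:R + 1 - _]addrC addKr mulr1 => E.
have -> : h i.+1 - h i = 2 `^ a * x `^ (- a).
  rewrite /h -(natr1 i) opprK addrC -mulrBr -[X in _ * X]opprB E.
  rewrite (_ : 1 - a - 1 = - a); last by ring.
  by field; rewrite subr_eq0 gt_eqF.
have x2 : x <= 2 * i%:R.
  by apply: (le_trans (ltW xi)); rewrite -natr1 mulr_natl mulr2n lerD2l.
have -> : i%:R `^ (- a) = 2 `^ a * (2 * i%:R) `^ (- a).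
  rewrite powRM// ?ler0n// mulrA -powRD ?subrr ?powRr0 ?mul1r//.
  by rewrite pnatr_eq0 implybT.
rewrite ler_pM2l ?powR_gt0//; apply: le_powRN => //; first exact: ltW.
exact: lt_trans ix.
Qed.

Lemma powRN12 (R : realType) (x : R) : 0 <= x ->
  x `^ (- (1 / 2)) = (Num.sqrt x)^-1.
Proof. by move=> x0; rewrite powRN div1r powR12_sqrt. Qed.

(** Each term is at most [3 (sqrt (i+1) - sqrt i)]: this difference is the inverse of
    [sqrt (i+1) + sqrt i], which is at most [3 sqrt i]. *)
Lemma sum_powRN12_le (R : realType) (N : nat) :
  \sum_(1 <= i < N) i%:R `^ (- (1 / 2)) <= 3 * Num.sqrt (N%:R : R).
Proof.
have [N1|/ltnW N1] := leqP N 1.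
  by rewrite big_geq// mulr_ge0// sqrtr_ge0.
pose h (i : nat) : R := 3 * Num.sqrt i%:R.
apply: (@le_trans _ _ (\sum_(1 <= i < N) (h i.+1 - h i))); last first.
  by rewrite telescope_sumr// gerBl mulr_ge0// sqrtr_ge0.
rewrite !big_nat; apply: ler_sum => i /andP[i1 _].
rewrite powRN12 ?ler0n// /h -mulrBr.
set s := Num.sqrt i%:R; set t := Num.sqrt _.
have s2 : s ^+ 2 = i%:R by rewrite sqr_sqrtr// ler0n.
have t2 : t ^+ 2 = s ^+ 2 + 1 by rewrite s2 sqr_sqrtr ?ler0n// natr1.
have s1 : 1 <= s by rewrite -[1]sqrtr1 ler_sqrt ?ltr01 ?ler1n// ltr0n.
have t0 : 0 <= t by exact: sqrtr_ge0.
rewrite -[s^-1]mul1r ler_pdivrMr; last by lra.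
have ts : t <= 2 * s by nra.
have : (t - s) * (t + s) = 1 by rewrite -subr_sqr t2; ring.
have : s <= t by nra.
nra.
Qed.

(** The minimum switches near [N = n^theta]. Up to there the sum of [i^(-1/2)] is of order [sqrt N];
    beyond, the convergent tail of [n i^(-1/2 - 1/theta)] has the same order. *)
Lemma sum_min_le (R : realType) (theta : R) (n M : nat) :
  0 < theta -> theta < 1 -> (1 <= n)%N ->
  \sum_(1 <= i < M) i%:R `^ (- (1 / 2)) *
    Num.min 1 (n%:R * i%:R `^ (- theta^-1)) <=
  (3 + 2 `^ theta^-1 / (theta^-1 - 1)) * Num.sqrt 2 *
    Num.sqrt (n%:R `^ theta) :> R.
Proof.
move=> t0 t1 n1.
have a1 : 1 < theta^-1 by rewrite invf_gt1.
set a := theta^-1 in a1 *.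
have a0 : 0 < a by apply: lt_trans a1.
have nt1 : 1 <= n%:R `^ theta :> R.
  rewrite [leLHS](_ : _ = 1 `^ theta); last by rewrite powR1.
  by rewrite ge0_ler_powR ?nnegrE ?ler01 ?ler0n ?ler1n// ltW.
(* Rounding up gives [n <= N^a]; the cost [N <= 2 n^theta] is the source of the factor [sqrt 2]. *)
pose N := (Num.truncn (n%:R `^ theta : R)).+1.
have NP : n%:R `^ theta < N%:R <= 2 * n%:R `^ theta.
  have /andP[h1 h2] := truncn_itv (le_trans ler01 nt1).
  rewrite h2/= /N -natr1; move: h1 nt1; lra.
have N1 : (1 <= N)%N by [].
have nN : n%:R <= N%:R `^ a.
  have -> : n%:R = (n%:R `^ theta) `^ a :> R.
    by rewrite -powRrM mulfV ?gt_eqF// powRr1// ler0n.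
  case/andP: NP => /ltW NP _.
  by rewrite ge0_ler_powR ?nnegrE ?powR_ge0 ?ler0n// ltW.
have C0 : 0 <= 2 `^ a / (a - 1) by rewrite divr_ge0 ?powR_ge0// subr_ge0 ltW.
apply: (@le_trans _ _ ((3 + 2 `^ a / (a - 1)) * Num.sqrt N%:R)); last first.
  rewrite -mulrA -sqrtrM//; apply: ler_wpM2l; first by rewrite addr_ge0.
  by case/andP: NP => _ ?; rewrite ler_wsqrtr.
have sub1 (i : nat) : i%:R `^ (- (1 / 2)) *
    Num.min 1 (n%:R * i%:R `^ (- a)) <= i%:R `^ (- (1 / 2)) :> R.
  by rewrite ler_piMr ?powR_ge0// ge_min lexx.
have sum_ge0 K L : 0 <= \sum_(K <= i < L) i%:R `^ (- (1 / 2)) *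
    Num.min 1 (n%:R * i%:R `^ (- a)) :> R.
  apply: sumr_ge0 => i _.
  by rewrite mulr_ge0 ?powR_ge0// le_min ler01 mulr_ge0 ?powR_ge0.
(* The terms being nonnegative, the range is enlarged so that it contains the cutoff [N] whatever
   [M] is. *)
apply: (@le_trans _ _ (\sum_(1 <= i < N + M) i%:R `^ (- (1 / 2)) *
    Num.min 1 (n%:R * i%:R `^ (- a)))).
  have [M0|M0] := leqP 1 M; last first.
    by rewrite big_geq ?sum_ge0// ltnW.
  by rewrite (@big_cat_nat _ _ _ M 1 (N + M)) ?leq_addl//= lerDl.
rewrite (@big_cat_nat _ _ _ N 1 (N + M)) ?leq_addr//= mulrDl lerD//.
  by apply: le_trans (sum_powRN12_le R N); apply: ler_sum => i _.
(* Here [i^(-1/2) <= N^(-1/2)] and [n <= N^a]; with the tail bound [N^(1-a)] the powers of [N]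
   combine to [N^(1/2)]. *)
apply: (@le_trans _ _ (\sum_(N <= i < N + M)
    ((Num.sqrt N%:R)^-1 * N%:R `^ a * i%:R `^ (- a)))).
  rewrite !big_nat; apply: ler_sum => i /andP[Ni _].
  have i0 : 0 < i%:R :> R by rewrite ltr0n (leq_trans _ Ni).
  rewrite -mulrA; apply: ler_pM; rewrite ?powR_ge0//.
  - rewrite powRN12 ?ler0n// lef_pV2 ?posrE ?sqrtr_gt0 ?ltr0n//;
      last exact: leq_trans Ni.
    by rewrite ler_wsqrtr ?ler_nat.
  - by rewrite ge_min ler_wpM2r ?orbT// powR_ge0.
rewrite -mulr_sumr.
apply: (le_trans (ler_wpM2l _ (sum_powRN_le (N + M) a1 N1))).
  by rewrite mulr_ge0 ?powR_ge0// invr_ge0 sqrtr_ge0.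
have N0 : N%:R != 0 :> R by rewrite pnatr_eq0.
rewrite mulrCA -[_ * _ * _ `^ (1 - a)]mulrA -powRD ?N0 ?implybT//.
rewrite addrCA subrr addr0 powRr1 ?ler0n// ler_wpM2l//.
rewrite ler_pdivrMl ?sqrtr_gt0 ?ltr0n//.
by rewrite -expr2 sqr_sqrtr// ler0n.
Qed.

(** * The counting function [alpha] *)

Lemma sum_urn_probabilities_le1 (R : realType) (p : nat -> R) (M : nat) :
  urn_probabilities p -> \sum_(1 <= i < M) p i <= 1.
Proof.
move=> [p0 _ p1]; rewrite -lee_fin -p1 -sumEFin; apply: nneseries_lim_ge.
by move=> i i1 _; rewrite lee_fin ltW// p0.
Qed.

Lemma urn_probability_le1 (R : realType) (p : nat -> R) (i : nat) :
  urn_probabilities p -> (1 <= i)%N -> p i <= 1.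
Proof.
move=> hp i1; apply: le_trans (sum_urn_probabilities_le1 i.+1 hp).
rewrite big_nat_recr//= lerDr; have [p0 _ _] := hp.
by rewrite big_nat; apply: sumr_ge0 => j /andP[/p0/ltW].
Qed.

(** The set defining [alpha] is bounded and contains [m], so its maximum exists and the default
    value 0 is not taken. *)
Lemma le_alpha (R : realType) (p : nat -> R) (x : R) (m : nat) :
  urn_probabilities p -> 0 < x -> (1 <= m)%N -> 1 / x <= p m ->
  (m <= alpha p x)%N.
Proof.
move=> hp x0 m1 xm; have [_ pdecr _] := hp.
pose Q (j : nat) := (1 <= j)%N && (1 / x <= p j).
(* By monotonicity the first [j] urns all have probability at least [1/x], and these add up to at
   most 1. *)
have Qle j : Q j -> (j <= Num.truncn x)%N.
  move=> /andP[j1 xj]; rewrite truncn_ge_nat; last exact: ltW.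
  rewrite -[x]mul1r -ler_pdivrMr//.
  apply: le_trans (sum_urn_probabilities_le1 j.+1 hp).
  rewrite [leLHS](_ : _ = \sum_(1 <= i < j.+1) 1 / x).
    rewrite !big_nat; apply: ler_sum => i /andP[i1 ij].
    by apply: (le_trans xj); apply: pdecr.
  by rewrite sumr_const_nat subSS subn0 mulr_natl mul1r.
have Qm : Q m by rewrite /Q m1.
have [M QM Mmax] := ex_maxnP (ex_intro _ m Qm) Qle.
rewrite /alpha; case: xgetP => [a _ [_ _ h]|/(_ M) []].
  exact: h.
case/andP: QM => M1 xM; split => // j j1 xj.
by apply: Mmax; rewrite /Q j1.
Qed.

(** The integer part [m] of [y = (b n)^theta] satisfies [p m >= b m^(-1/theta) >= 1/n], hence
    [m <= alpha]. The factor [1/2] absorbs the rounding, since [y < m + 1 <= 2 m]. *)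
Lemma alpha_ge_powR (R : realType) (theta b : R) (p : nat -> R) (i0 : nat) :
  0 < theta -> 0 < b -> urn_probabilities p ->
  (forall i, (i0 <= i)%N -> (1 <= i)%N -> b * i%:R `^ (- theta^-1) <= p i) ->
  \forall n \near \oo,
    b `^ theta / 2 * n%:R `^ theta <= (alpha p n%:R)%:R :> R.
Proof.
move=> t0 b0 hp pge.
near=> n.
have n0 : 0 < n%:R :> R by near: n; exists 1%N => // n /=; rewrite ltr0n.
have bn0 : 0 <= b * n%:R by rewrite mulr_ge0// ltW.
set y : R := (b * n%:R) `^ theta.
(* This puts [m] beyond [i0], where the lower bound on [p] is available. *)
have iy : i0.+1%:R <= y.
  have -> : i0.+1%:R = (i0.+1%:R `^ theta^-1) `^ theta :> R.
    by rewrite -powRrM mulVf ?gt_eqF// powRr1.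
  apply: ge0_ler_powR; rewrite ?nnegrE ?powR_ge0//; first exact: ltW.
  rewrite -ler_pdivrMl//.
  by near: n; exact: nbhs_infty_ger.
have y1 : 1 <= y by apply: le_trans iy; rewrite ler1n.
have y0 : 0 <= y by apply: le_trans y1.
have /andP[my ym] := truncn_itv y0.
set m := Num.truncn y in my ym.
have im : (i0.+1 <= m)%N by rewrite truncn_ge_nat.
have m0 : 0 < m%:R :> R by rewrite ltr0n (leq_trans _ im).
apply: (@le_trans _ _ m%:R).
  rewrite mulrAC -powRM ?ltW// -/y.
  have : 1 <= m%:R :> R by rewrite ler1n (leq_trans _ im).
  by move: ym; rewrite -natr1; lra.
rewrite ler_nat le_alpha//.
  by rewrite (leq_trans _ im).
apply: le_trans (pge m (ltnW im) (leq_ltn_trans (leq0n _) im)).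
rewrite powRN ler_pdivlMr ?powR_gt0// mulrAC mul1r ler_pdivrMr//.
have -> : b * n%:R = y `^ theta^-1.
  by rewrite /y -powRrM mulfV ?gt_eqF// powRr1.
by rewrite ge0_ler_powR ?nnegrE ?powR_ge0 ?invr_ge0// ltW.
Unshelve. all: by end_near.
Qed.

(** * Comparison with the exact power law *)

(** [E] is the derivative of [G] with respect to [log x], so relative errors control [G]. In the
    mean value theorem [min(1, n x) / x = min(1/x, n)] is nonincreasing, so the intermediate point
    may be lowered to [l]. *)
Lemma log_lipschitz (R : realType) (G E : R -> R) (C n l a b : R) :
  0 <= C -> 0 < l ->
  (forall x, l <= x <= 1 -> is_derive x 1 G (E x / x)) ->
  (forall x, l <= x <= 1 -> `|E x| <= C * Num.min 1 (n * x)) ->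
  l <= a <= 1 -> l <= b <= 1 ->
  `|G a - G b| <= C * Num.min 1 (n * l) * (`|a - b| / l).
Proof.
move=> C0 l0 GE Ele; wlog ab : a b / a < b => [wl la1 lb1|].
  have [ab|ab|->] := ltgtP a b; first exact: wl.
    by rewrite distrC [`|a - b|]distrC; apply: wl.
  by rewrite !subrr normr0 mul0r mulr0.
move=> /andP[la _] /andP[_ b1].
have GEab x : a <= x <= b -> is_derive x 1 G (E x / x).
  by move=> /andP[ax xb]; apply: GE; rewrite (le_trans la)// (le_trans xb).
have [x /andP[ax xb] E1] := MVT_closed ab GEab.
have lx : l <= x by apply: le_trans (ltW ax).
have x0 : 0 < x by apply: lt_le_trans lx.
rewrite distrC E1 normrM [`|a - b|]distrC mulrCA mulrC ler_wpM2l//.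
rewrite normrM normfV (gtr0_norm x0).
have lx1 : l <= x <= 1 by rewrite lx/= (le_trans (ltW xb)).
have := Ele x lx1 => Ex.
apply: (le_trans (ler_wpM2r _ Ex)); first by rewrite invr_ge0 ltW.
rewrite -!mulrA ler_wpM2l//.
rewrite !minr_pMl ?invr_ge0 ?(ltW x0) ?(ltW l0)// !mulfK ?gt_eqF// !mul1r.
by rewrite le_min !ge_min lexx orbT andbT lef_pV2// lx.
Qed.

Lemma is_derive_powRN (R : realType) (a x : R) : 0 < x ->
  is_derive x 1 (fun y => y `^ (- a)) (- a * (x `^ (- a) / x)).
Proof.
move=> x0; apply: is_derive_eq (is_derive1_powR (- a) x0) _.
rewrite powRB; last by rewrite (gt_eqF x0) implybT.
by rewrite powRr1// ltW.
Qed.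

Lemma powRN_diff_bound (R : realType) (a x y : R) : 0 < a -> 0 < x ->
  x <= y <= x + 1 -> 0 <= x `^ (- a) - y `^ (- a) <= a / x * x `^ (- a).
Proof.
move=> a0 x0 /andP[xy yx1]; rewrite subr_ge0 (le_powRN (ltW a0) x0 xy)/=.
move: xy; rewrite le_eqVlt => /predU1P[<-|xy].
  by rewrite subrr mulr_ge0 ?powR_ge0// divr_ge0// ltW.
have [||z /andP[xz zy] E] := @MVT_closed R (fun y => y `^ (- a))
  (fun y => - a * (y `^ (- a) / y)) x y => //.
  by move=> z /andP[xz _]; apply: is_derive_powRN; exact: lt_le_trans xz.
have z0 : 0 < z by apply: lt_trans xz.
rewrite -opprB E mulNr mulNr opprK -!mulrA ler_wpM2l//; first exact: ltW.
rewrite mulrA [leRHS]mulrC -[leRHS]mulr1; apply: ler_pM.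
- by rewrite divr_ge0 ?powR_ge0// ltW.
- by rewrite subr_ge0 ltW.
- apply: ler_pM; rewrite ?powR_ge0 ?invr_ge0 ?(ltW z0)//.
    exact: le_powRN (ltW a0) x0 (ltW xz).
  by rewrite lef_pV2 ?posrE// ltW.
- by rewrite lerBlDl.
Qed.

(* The function [x |-> x F(c x^(-1/theta))] has derivative
   [F - theta^-1 D] at [c x^(-1/theta)]: this is where [D - theta F] comes
   from. *)
Lemma telescoping_step (R : realType) (a c x : R) (F D : R -> R) :
  0 <= a -> 0 < c -> 0 < x -> c * x `^ (- a) <= 1 ->
  (forall y : R, 0 < y <= 1 -> is_derive y 1 F (D y / y)) ->
  let q (y : R) := c * y `^ (- a) in
  exists2 y : R, x < y < x + 1 &
    (x + 1) * F (q (x + 1)) - x * F (q x) = F (q y) - a * D (q y).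
Proof.
move=> a0 c0 x0 qx FD q.
have [||y xy E] := @MVT_closed R (fun y => y * F (q y))
  (fun y => F (q y) - a * D (q y)) x (x + 1); first by rewrite ltrDl.
  move=> y /andP[xy _]; have y0 : 0 < y by apply: lt_le_trans xy.
  have qy0 : 0 < q y by rewrite mulr_gt0 ?powR_gt0.
  have qy1 : q y <= 1.
    by apply: le_trans qx; rewrite ler_wpM2l ?(ltW c0)// le_powRN// ltW.
  have dq : is_derive y 1 q (- a * (q y / y)).
    apply: is_derive_eq (is_deriveZ c (is_derive_powRN a y0)) _.
    by rewrite /q /GRing.scale/=; ring.
  have qy01 : 0 < q y <= 1 by rewrite qy0.
  have dF := is_derive1_comp (FD _ qy01) dq.
  apply: is_derive_eq (is_deriveM (is_derive_id y 1) dF) _.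
  rewrite /GRing.scale/= /comp; field.
  by rewrite !gt_eqF.
by exists y => //; rewrite E [x + 1]addrC addrK mulr1.
Qed.

(** By [telescoping_step] the added difference equals [- G (q y)] for some [y] between [i] and
    [i+1], where [G = D - theta F]. What remains is [G u - G (q y)], controlled by [log_lipschitz]
    and the relative distance of [u] and [q y]. *)
Lemma term_telescoping_bound (R : realType) (theta c C n : R) (F D E : R -> R)
    (i : nat) (u e : R) :
  0 < theta -> theta < 1 -> 0 < c -> 0 <= C -> 0 <= n ->
  (forall x : R, 0 < x <= 1 -> is_derive x 1 F (D x / x)) ->
  (forall x : R, 0 < x <= 1 -> is_derive x 1 D (E x / x)) ->
  (forall x : R, 0 < x <= 1 -> `|D x| <= C * Num.min 1 (n * x)) ->
  (forall x : R, 0 < x <= 1 -> `|E x| <= C * Num.min 1 (n * x)) ->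
  let q (x : R) := c * x `^ (- theta^-1) in
  (1 <= i)%N -> q i%:R <= 1 -> `|e| <= 1 / 2 -> u = q i%:R * (1 + e) ->
  u <= 1 ->
  `|D u - theta * F u +
     theta * (i.+1%:R * F (q i.+1%:R) - i%:R * F (q i%:R))| <=
  4 * 2 `^ theta^-1 * (1 + c) * C *
    (Num.min 1 (n * i%:R `^ (- theta^-1)) * (`|e| + theta^-1 / i%:R)).
Proof.
move=> t0 t1 c0 C0 n0 FD DE Db Eb q i1 qi1 e12 uE u1.
set a := theta^-1; have a0 : 0 < a by rewrite invr_gt0.
have i0 : 0 < i%:R :> R by rewrite ltr0n.
have [y /andP[iy yi] Ey] := telescoping_step (ltW a0) c0 i0 qi1 FD.
rewrite -/a -/(q _) -/(q _) -/(q _) in Ey; rewrite natr1 in Ey.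
rewrite Ey mulrBr mulrA divff ?gt_eqF// mul1r.
pose G x := D x - theta * F x.
rewrite (_ : _ + _ = G u - G (q y)); last by rewrite /G; ring.
have qi0 : 0 < q i%:R by rewrite mulr_gt0 ?powR_gt0.
(* A common lower bound for [u] and [q y]: the factor 2 comes from [1 + e >= 1/2], the factor [2^a]
   from [y <= 2 i]. *)
pose l := q i%:R / (2 * 2 `^ a).
have p20 : 0 < 2 `^ a :> R by rewrite powR_gt0.
have p21 : 1 <= 2 `^ a :> R.
  by rewrite -[leLHS](powRr0 2) ler_powR ?ler1n// ltW.
have l0 : 0 < l by rewrite divr_gt0// mulr_gt0.
have lq : l <= q i%:R.
  by rewrite ler_pdivrMr ?mulr_gt0// ler_peMr ?ltW//; lra.
have lu : l <= u <= 1.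
  rewrite u1 andbT uE ler_wpM2l ?(ltW qi0)//.
  have : (2 * 2 `^ a)^-1 <= 2^-1 :> R.
    by rewrite lef_pV2 ?posrE ?mulr_gt0//; lra.
  by move: e12; rewrite ler_norml; lra.
have y0 : 0 < y by apply: lt_trans iy.
have qyi : q y <= q i%:R.
  by rewrite /q ler_wpM2l ?(ltW c0)// (le_powRN (ltW a0)) ?(ltW iy).
have lqy : l <= q y <= 1.
  rewrite (le_trans qyi)// andbT.
  apply: (@le_trans _ _ (q (2 * i%:R))).
    have -> : q (2 * i%:R) = q i%:R / 2 `^ a.
      by rewrite /q powRM ?ler0n// -/a (powRN 2); ring.
    rewrite /l ler_wpM2l ?(ltW qi0)// lef_pV2 ?posrE ?mulr_gt0//.
    by rewrite ler_peMl ?(ltW p20)// ler1n.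
  rewrite /q ler_wpM2l ?(ltW c0)// (le_powRN (ltW a0))//.
  apply: (le_trans (ltW yi)); rewrite mulr_natl mulr2n lerD2l.
  by rewrite ler1n.
have dG x : l <= x <= 1 -> is_derive x 1 G ((E x - theta * D x) / x).
  move=> /andP[lx x1]; have x01 : 0 < x <= 1 by rewrite (lt_le_trans l0).
  apply: is_derive_eq
    (is_deriveB (DE _ x01) (is_deriveZ theta (FD _ x01))) _.
  by rewrite /GRing.scale/=; ring.
have bG x : l <= x <= 1 ->
    `|E x - theta * D x| <= 2 * C * Num.min 1 (n * x).
  move=> /andP[lx x1]; have x01 : 0 < x <= 1 by rewrite (lt_le_trans l0).
  apply: (le_trans (ler_normB _ _)); rewrite mulr2n !mulrDl !mul1r lerD ?Eb//.
  apply: le_trans (Db _ x01); rewrite normrM (gtr0_norm t0).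
  by rewrite ler_piMl// ltW.
have C20 : 0 <= 2 * C by rewrite mulr_ge0.
apply: (le_trans (log_lipschitz C20 l0 dG bG lu lqy)).
have -> : 4 * 2 `^ a * (1 + c) * C * (Num.min 1 (n * i%:R `^ (- a)) *
    (`|e| + a / i%:R)) = 2 * C * ((1 + c) * Num.min 1 (n * i%:R `^ (- a))) *
    (2 * 2 `^ a * (`|e| + a / i%:R)) by ring.
apply: ler_pM.
- by rewrite mulr_ge0// le_min ler01 mulr_ge0// ltW.
- by rewrite divr_ge0// ltW.
(* The factor [1 + c] dominates both 1 and [c], which removes [c] from inside the minimum. *)
- rewrite ler_wpM2l// minr_pMr ?addr_ge0 ?(ltW c0)// mulr1.
  rewrite le_min ge_min lerDl (ltW c0)/= ge_min.
  apply/orP; right; rewrite [leRHS]mulrCA ler_wpM2l//; apply: (le_trans lq).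
  by rewrite /q ler_wpM2r ?powR_ge0// lerDr.
have -> : `|u - q y| / l = 2 * 2 `^ a * (`|u - q y| / q i%:R).
  by rewrite /l; field; rewrite !gt_eqF.
rewrite ler_wpM2l ?mulr_ge0 ?(ltW p20)//.
rewrite ler_pdivrMr//.
(* The first term is the deviation of [u] from the power law, the second the shift from [i] to [y],
   of relative size at most [a / i]. *)
have -> : u - q y = q i%:R * e + c * (i%:R `^ (- a) - y `^ (- a)).
  by rewrite uE /q -/a; ring.
apply: (le_trans (ler_normD _ _)).
rewrite normrM (gtr0_norm qi0) mulrDl [`|e| * _]mulrC lerD2l.
have := @powRN_diff_bound R a i%:R y a0 i0; rewrite (ltW iy) (ltW yi).
move=> /(_ isT)/andP[h1 h2].
rewrite normrM (gtr0_norm c0) (ger0_norm h1) /q -/a mulrCA.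
by rewrite ler_wpM2l// ltW.
Qed.

(* [F], [x F'(x)] and [x (x F'(x))'] are all [O(min(1, n x))] on [(0, 1]]. *)
Definition log_derivatives_bounded (R : realType) (C n : R) (F D E : R -> R) :=
  forall x : R, 0 < x <= 1 ->
  [/\ is_derive x 1 F (D x / x), is_derive x 1 D (E x / x) &
    [/\ `|F x| <= C * Num.min 1 (n * x), `|D x| <= C * Num.min 1 (n * x) &
      `|E x| <= C * Num.min 1 (n * x)]].

(** * Summation of the errors over the urns *)

Lemma powR_ge_near (R : realType) (s Y : R) : 0 < s ->
  \forall n \near \oo, Y <= n%:R `^ s.
Proof.
move=> s0; near=> n.
have [Y0|Y0] := leP Y 0; first by rewrite (le_trans Y0) ?powR_ge0.
have -> : Y = (Y `^ s^-1) `^ s by rewrite -powRrM mulVf ?gt_eqF// powRr1 ?ltW.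
rewrite ge0_ler_powR ?nnegrE ?powR_ge0 ?ler0n ?(ltW s0)//.
by near: n; exact: nbhs_infty_ger.
Unshelve. all: by end_near.
Qed.

Lemma cvg_powRN (R : realType) (s : R) : 0 < s ->
  n%:R `^ (- s) @[n --> \oo] --> (0 : R).
Proof.
move=> s0; apply/cvgrPdist_le => e e0; near=> n.
rewrite sub0r normrN ger0_norm ?powR_ge0// powRN.
have n0 : e^-1 <= n%:R `^ s by near: n; exact: powR_ge_near.
by rewrite -[e]invrK lef_pV2 ?posrE ?invr_gt0// (lt_le_trans _ n0) ?invr_gt0.
Unshelve. all: by end_near.
Qed.

(** The shift error [theta^-1 / i] is itself [o(i^(-1/2))], so it shares [delta] in equal halves
    with [eps]. *)
Lemma relative_error_near (R : realType) (theta c delta : R) (eps : nat -> R) :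
  0 < theta -> 0 < c -> 0 < delta ->
  eps =o_\oo (fun i : nat => i%:R `^ (- (1 / 2))) ->
  exists2 N, (1 <= N)%N & forall i, (N <= i)%N ->
    [/\ c * i%:R `^ (- theta^-1) <= 1, `|eps i| <= 1 / 2 &
      `|eps i| + theta^-1 / i%:R <= delta * i%:R `^ (- (1 / 2))].
Proof.
move=> t0 c0 d0 /eqoP ho.
suff [N _ HN] : \forall i \near \oo,
    [/\ c * i%:R `^ (- theta^-1) <= 1, `|eps i| <= 1 / 2 &
      `|eps i| + theta^-1 / i%:R <= delta * i%:R `^ (- (1 / 2))].
  by exists N.+1 => // i Ni; apply: HN; exact: ltnW.
have ho1 := ho _ (divr_gt0 d0 (ltr0n _ 2)).
have ho2 := ho (1 / 2) (divr_gt0 ltr01 (ltr0n _ 2)).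
near=> i.
have i0 : 0 < i%:R :> R by near: i; exists 1%N => // n /=; rewrite ltr0n.
have i1 : 1 <= i%:R :> R by rewrite ler1n -(ltr0n R).
have ia : i%:R `^ (- (1 / 2)) <= 1 :> R.
  by rewrite powRN12 ?ler0n// invf_le1 ?sqrtr_gt0// -[leLHS]sqrtr1 ler_wsqrtr.
have h1 : `|eps i| <= delta / 2 * i%:R `^ (- (1 / 2)).
  rewrite -[X in _ * X]ger0_norm ?powR_ge0//.
  by near: i.
have h2 : `|eps i| <= 1 / 2 * i%:R `^ (- (1 / 2)).
  rewrite -[X in _ * X]ger0_norm ?powR_ge0//.
  by near: i.
split.
- rewrite powRN ler_pdivrMr ?powR_gt0// mul1r.
  by near: i; apply: powR_ge_near; rewrite invr_gt0.
- by apply: (le_trans h2); rewrite ler_piMr// divr_ge0.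
rewrite [leRHS](_ : _ = delta / 2 * i%:R `^ (- (1 / 2)) +
  delta / 2 * i%:R `^ (- (1 / 2))); last by field.
apply: lerD => //.
rewrite ler_pdivrMr// powRN12 ?ler0n//.
set s := Num.sqrt _.
have s0 : 0 < s by rewrite sqrtr_gt0.
have -> : i%:R = s * s by rewrite -expr2 sqr_sqrtr// ltW.
rewrite mulrA mulfVK ?gt_eqF// mulrC -ler_pdivrMr ?divr_gt0//.
rewrite /s -powR12_sqrt ?ler0n//.
by near: i; apply: powR_ge_near; rewrite invr_gt0.
Unshelve. all: by end_near.
Qed.

(** The order of the quantifiers matters: [K] is fixed before [delta], and [B] depends on [delta]
    but not on [n], [M] or the functions. The last term is the boundary term of the telescoping at
    [M]; it vanishes as [M] grows with [n] fixed. *)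
Lemma partial_sum_bound (R : realType) (theta c C : R) (p eps : nat -> R) :
  0 < theta -> theta < 1 -> 0 < c -> 0 <= C -> urn_probabilities p ->
  eps =o_\oo (fun i : nat => i%:R `^ (- (1 / 2))) ->
  (forall i : nat, (1 <= i)%N ->
    p i = c * i%:R `^ (- theta^-1) * (1 + eps i)) ->
  exists2 K, 0 <= K & forall delta, 0 < delta -> exists B,
    forall (n M : nat) (F D E : R -> R), (1 <= n)%N -> (1 <= M)%N ->
    log_derivatives_bounded C n%:R F D E ->
    `|\sum_(1 <= i < M) (D (p i) - theta * F (p i))| <=
      B + K * delta * Num.sqrt (n%:R `^ theta) +
      C * n%:R * c * M%:R `^ (- (theta^-1 - 1)).
Proof.
move=> t0 t1 c0 C0 hp ho pE; set a := theta^-1.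
have a0 : 0 < a by rewrite invr_gt0.
have a1 : 1 < a by rewrite invf_gt1.
pose K1 := 4 * 2 `^ a * (1 + c) * C.
pose K2 := (3 + 2 `^ a / (a - 1)) * Num.sqrt 2.
have K10 : 0 <= K1.
  by rewrite /K1 mulr_ge0// mulr_ge0 ?addr_ge0 ?(ltW c0)// mulr_ge0 ?powR_ge0.
have K20 : 0 <= K2.
  rewrite mulr_ge0 ?sqrtr_ge0// addr_ge0// divr_ge0 ?powR_ge0//.
  by rewrite subr_ge0 ltW.
exists (K1 * K2); first exact: mulr_ge0.
move=> delta d0.
have [N N1 HN] := relative_error_near t0 c0 d0 ho.
(* [2 C N] bounds the terms before [N], where the asymptotics say nothing; [C N] bounds the boundary
   term at [N]. *)
exists (3 * C * N%:R) => n M F D E n1 M1 FDE.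
have p01 i : (1 <= i)%N -> 0 < p i <= 1.
  by move=> i1; have [-> // _ _] := hp; rewrite urn_probability_le1.
have minle1 x : C * Num.min 1 (n%:R * x) <= C.
  by rewrite ler_piMr// ge_min lexx.
pose G x := D x - theta * F x.
have Gle i : (1 <= i)%N -> `|G (p i)| <= 2 * C.
  move=> /p01/FDE[_ _ [hF hD _]]; apply: (le_trans (ler_normB _ _)).
  rewrite mulr2n mulrDl mul1r lerD ?(le_trans hD)//.
  rewrite normrM (gtr0_norm t0); apply: le_trans (minle1 (p i)).
  by apply: le_trans hF; rewrite ler_piMl// ltW.
have S1 L : `|\sum_(1 <= i < L) G (p i)| <= 2 * C * L%:R.
  apply: (le_trans (ler_norm_sum _ _ _)).
  apply: (@le_trans _ _ (\sum_(1 <= i < L) (2 * C))).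
    by rewrite !big_nat; apply: ler_sum => i /andP[/Gle].
  rewrite sumr_const_nat -[leLHS]mulr_natr ler_wpM2l ?mulr_ge0//.
  by rewrite ler_nat leq_subr.
have CM : 0 <= C * n%:R * c * M%:R `^ (- (a - 1)).
  by rewrite !mulr_ge0 ?powR_ge0// ltW.
have Kd : 0 <= K1 * K2 * delta * Num.sqrt (n%:R `^ theta).
  exact: mulr_ge0 (mulr_ge0 (mulr_ge0 K10 K20) (ltW d0)) (sqrtr_ge0 _).
have [MN|/ltnW NM] := leqP M N.
  apply: (le_trans (S1 M)); rewrite -addrA.
  apply: (@le_trans _ _ (3 * C * N%:R)); last by rewrite lerDl addr_ge0.
  by rewrite ler_pM ?mulr_ge0// ?ler_nat// ler_wpM2r// ler_nat.
pose q (x : R) := c * x `^ (- a).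
pose h (i : nat) := i%:R * F (q i%:R).
have hbound i : (N <= i)%N -> `|h i| <= i%:R * (C * Num.min 1 (n%:R * q i%:R)).
  move=> Ni; have [qi1 _ _] := HN i Ni.
  have i0 : 0 < i%:R :> R by rewrite ltr0n (leq_trans N1).
  have q01 : 0 < q i%:R <= 1 by rewrite qi1 andbT mulr_gt0 ?powR_gt0.
  by have [_ _ [hF _ _]] := FDE _ q01; rewrite normrM ger0_norm// ler_wpM2l.
have S2 : `|\sum_(N <= i < M) (G (p i) + theta * (h i.+1 - h i))| <=
    K1 * K2 * delta * Num.sqrt (n%:R `^ theta).
  apply: (le_trans (ler_norm_sum _ _ _)).
  apply: (@le_trans _ _ (K1 * delta * \sum_(1 <= i < M)
      i%:R `^ (- (1 / 2)) * Num.min 1 (n%:R * i%:R `^ (- a)))); last first.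
    rewrite [leRHS](_ : _ = K1 * delta * (K2 * Num.sqrt (n%:R `^ theta))).
      apply: ler_wpM2l; first exact: mulr_ge0 K10 (ltW d0).
      exact: sum_min_le.
    by ring.
  rewrite (@big_cat_nat _ _ _ N 1 M)//= mulrDr; apply: ler_wpDl.
    apply: mulr_ge0; first by rewrite mulr_ge0// ltW.
    by apply: sumr_ge0 => i _; rewrite mulr_ge0 ?powR_ge0.
  rewrite mulr_sumr !big_nat; apply: ler_sum => i /andP[Ni _].
  have [qi1 ei1 ei2] := HN i Ni.
  have i1 : (1 <= i)%N by apply: leq_trans Ni.
  have /andP[_ pi1] := p01 i i1.
  have := @term_telescoping_bound R theta c C n%:R F D E i (p i) (eps i)
    t0 t1 c0 C0 (ler0n _ _) (fun x h => let: And3 k _ _ := FDE x h in k)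
    (fun x h => let: And3 _ k _ := FDE x h in k)
    (fun x h => let: And3 _ _ (And3 _ k _) := FDE x h in k)
    (fun x h => let: And3 _ _ (And3 _ _ k) := FDE x h in k)
    i1 qi1 ei1 (pE i i1) pi1.
  move/le_trans; apply; rewrite -/a -/K1 -mulrA ler_wpM2l//.
  rewrite mulrA [leRHS]mulrC ler_wpM2l//.
(* At [N] the minimum is bounded by 1, which keeps the estimate free of [n]; at [M] it is bounded by
   [n q(M)], which gives the decay in [M]. *)
have S3 : `|theta * (h M - h N)| <=
    C * N%:R + C * n%:R * c * M%:R `^ (- (a - 1)).
  rewrite normrM (gtr0_norm t0); apply: (@le_trans _ _ `|h M - h N|).
    by rewrite ler_piMl// ltW.
  apply: (le_trans (ler_normB _ _)); rewrite addrC lerD//.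
    by apply: (le_trans (hbound N _)) => //; rewrite mulrC ler_wpM2r.
  apply: (le_trans (hbound M _)) => //.
  apply: (@le_trans _ _ (M%:R * (C * (n%:R * q M%:R)))).
    by rewrite !ler_wpM2l// ge_min lexx orbT.
  rewrite /q opprB powRB; last by rewrite pnatr_eq0 -lt0n M1 implybT.
  by rewrite powRr1// powRN le_eqVlt; apply/orP; left; apply/eqP; ring.
rewrite (@big_cat_nat _ _ _ N 1 M)//=.
have -> : \sum_(N <= i < M) (D (p i) - theta * F (p i)) =
    \sum_(N <= i < M) (G (p i) + theta * (h i.+1 - h i)) - theta * (h M - h N).
  rewrite -(telescope_sumr h NM) mulr_sumr -sumrB.
  by apply: eq_bigr => i _; rewrite addrK.
rewrite addrA.
apply: (le_trans (ler_normB _ _)).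
apply: (le_trans (lerD (le_trans (ler_normD _ _) (lerD (S1 N) S2)) S3)).
lra.
Qed.

(** [sqrt alpha] is eventually at least a constant times [n^(theta/2)]. In [partial_sum_bound] the
    coefficient of [n^(theta/2)] is made small through [delta], and [B] is negligible for large
    [n]. *)
Lemma cvg_series_over_sqrt_alpha (R : realType) (theta c C : R)
    (p eps : nat -> R) (F D E : nat -> R -> R) (S : nat -> R) :
  0 < theta -> theta < 1 -> 0 < c -> 0 <= C -> urn_probabilities p ->
  eps =o_\oo (fun i : nat => i%:R `^ (- (1 / 2))) ->
  (forall i : nat, (1 <= i)%N ->
    p i = c * i%:R `^ (- theta^-1) * (1 + eps i)) ->
  (forall n, log_derivatives_bounded C n%:R (F n) (D n) (E n)) ->
  (forall n, \sum_(1 <= i < M) (D n (p i) - theta * F n (p i))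
    @[M --> \oo] --> S n) ->
  S n / Num.sqrt (alpha p n%:R)%:R @[n --> \oo] --> (0 : R).
Proof.
move=> t0 t1 c0 C0 hp ho pE FDE hS.
have [K K0 HK] := partial_sum_bound t0 t1 c0 C0 hp ho pE.
have a1 : 0 < theta^-1 - 1 by rewrite subr_gt0 invf_gt1.
have Sbound delta : 0 < delta -> exists B, forall n, (1 <= n)%N ->
    `|S n| <= B + K * delta * Num.sqrt (n%:R `^ theta).
  move=> /HK[B HB]; exists B => n n1.
  (* The added zero is the limit of the boundary term, so that the inequality is a limit of those
     for partial sums. *)
  rewrite -[leRHS]addr0 -(mulr0 (C * n%:R * c)).
  apply: (ler_cvg_to (cvg_norm (hS n))
    (cvgD (cvg_cst _) (cvgM (cvg_cst _) (cvg_powRN a1)))).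
  near=> M; apply: HB (FDE n) => //.
  by near: M; exists 1%N.
have [N N1 HN] := relative_error_near t0 c0 ltr01 ho.
have b0 : 0 < c / 2 by rewrite divr_gt0.
have plb i : (N <= i)%N -> (1 <= i)%N -> c / 2 * i%:R `^ (- theta^-1) <= p i.
  move=> /HN[_ + _] i1; rewrite pE// ler_norml => /andP[e1 _].
  rewrite mulrAC; apply: ler_wpM2l; first by rewrite mulr_ge0 ?powR_ge0// ltW.
  by move: e1; lra.
have alb := alpha_ge_powR t0 b0 hp plb.
set k := (c / 2) `^ theta / 2 in alb.
have k0 : 0 < Num.sqrt k by rewrite sqrtr_gt0 divr_gt0 ?powR_gt0.
apply/cvgrPdist_lt => e e0.
(* This gives [K delta <= e sqrt k / 2], half of the allowance; [K + 1] keeps the denominator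
   positive when [K = 0]. The other half goes to [B]. *)
pose delta := e * Num.sqrt k / (2 * (K + 1)).
have K10 : 0 < K + 1 by rewrite ltr_wpDl.
have d0 : 0 < delta by rewrite !(divr_gt0, mulr_gt0).
have [B HB] := Sbound _ d0.
near=> n.
have n1 : (1 <= n)%N by near: n; exists 1%N.
set s := Num.sqrt (n%:R `^ theta).
have s1 : (2 * `|B| / (e * Num.sqrt k) + 1) <= s.
  rewrite /s -[leLHS]ger0_norm ?addr_ge0 ?divr_ge0 ?mulr_ge0 ?(ltW e0)
    ?(ltW k0)//.
  rewrite -sqrtr_sqr ler_wsqrtr//.
  by near: n; exact: powR_ge_near.
have ek : 0 < e * Num.sqrt k by rewrite mulr_gt0.
have s0 : 0 < s.
  by apply: lt_le_trans s1; rewrite ltr_wpDl// divr_ge0 ?mulr_ge0// ltW.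
have Bs : `|B| < e * Num.sqrt k / 2 * s.
  have : 2 * `|B| / (e * Num.sqrt k) < s.
    by apply: lt_le_trans s1; rewrite ltrDl.
  by rewrite ltr_pdivrMr//; lra.
have al : Num.sqrt k * s <= Num.sqrt (alpha p n%:R)%:R.
  rewrite -sqrtrM; last by rewrite divr_ge0 ?powR_ge0.
  by rewrite ler_wsqrtr//; near: n.
have al0 : 0 < Num.sqrt (alpha p n%:R)%:R :> R.
  by apply: lt_le_trans al; rewrite mulr_gt0.
rewrite sub0r normrN normrM normfV (gtr0_norm al0) ltr_pdivrMr//.
apply: (@lt_le_trans _ _ (e * (Num.sqrt k * s))); last first.
  by rewrite ler_wpM2l// ltW.
apply: (le_lt_trans (HB n n1)).
have Kd : K * delta <= e * Num.sqrt k / 2.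
  have -> : K * delta = K / (K + 1) * (e * Num.sqrt k / 2).
    by rewrite /delta; field; rewrite gt_eqF.
  rewrite ler_piMl//; first by rewrite divr_ge0// ltW.
  by rewrite ler_pdivrMr// mul1r lerDl.
have := ler_wpM2r (ltW s0) Kd.
have := ler_norm B.
rewrite -/s mulrA; move: Bs; lra.
Unshelve. all: by end_near.
Qed.

(** * Binomial probabilities *)

Lemma binomial_pmfE (R : realType) (n k : nat) (x : R) :
  binomial_pmf n x k = 'C(n, k)%:R * (x ^+ k * (1 - x) ^+ (n - k)).
Proof. by rewrite mulr_natl. Qed.

Lemma binomial_pmf0 (R : realType) (n : nat) (x : R) :
  binomial_pmf n x 0 = (1 - x) ^+ n.
Proof. by rewrite /binomial_pmf expr0 mul1r subn0 bin0. Qed.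

(** The identity [(k+1) C(n,k+1) = (n-k) C(n,k)] turns the derivative of the factor [(1-x)^(n-k)]
    into the next binomial probability. *)
Lemma is_derive_binomial_pmf (R : realType) (n k : nat) (x : R) : x != 0 ->
  is_derive x 1 (fun y : R => binomial_pmf n y k)
    ((k%:R * binomial_pmf n x k - k.+1%:R * binomial_pmf n x k.+1) / x).
Proof.
move=> x0.
have -> : (fun y : R => binomial_pmf n y k) =
    ('C(n, k)%:R : R) *: (((id : R -> R) ^+ k) *
      ((cst (1 : R) : R -> R) - (id : R -> R)) ^+ (n - k)).
  by apply/funext => y; rewrite /binomial_pmf -mulr_natl /GRing.scale/= !fctE.
apply: is_derive_eq.
have xk : k%:R * x ^+ k.-1 = k%:R * x ^+ k / x.
  case: k => [|k]; first by rewrite !mul0r.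
  by rewrite exprSr; field.
have /(congr1 (fun m => m%:R : R)) := mul_bin_left n k; rewrite !natrM => bin.
rewrite !binomial_pmfE [k.+1%:R * _]mulrA bin subnS exprS.
rewrite !fctE/= /GRing.scale/= xk.
by field.
Qed.

Lemma sum_binomial_pmf (R : realType) (n : nat) (x : R) :
  \sum_(k < n.+1) binomial_pmf n x k = 1.
Proof.
rewrite -[RHS](expr1n _ n) -(subrK x 1) exprDn; apply: eq_bigr => k _.
by rewrite /binomial_pmf mulrC.
Qed.

(** The bound by [n x] is Bernoulli's inequality. *)
Lemma one_sub_expr_min (R : realType) (n : nat) (x : R) : 0 <= x <= 1 ->
  1 - (1 - x) ^+ n <= Num.min 1 (n%:R * x).
Proof.
move=> /andP[x0 x1]; rewrite le_min gerBl exprn_ge0 ?subr_ge0//=.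
elim: n => [|n IH]; first by rewrite mul0r subrr.
rewrite [_ ^+ n.+1]exprS -(natr1 n).
have : 0 <= (1 - x) * (n%:R * x - (1 - (1 - x) ^+ n)).
  by rewrite mulr_ge0 ?subr_ge0.
have : 0 <= n%:R * x ^+ 2 by rewrite mulr_ge0 ?sqr_ge0.
lra.
Qed.

(** For [1 <= k <= n] the probabilities of the values 0 and [k] are distinct terms of a sum equal to
    1, hence [b_k <= 1 - b_0]; for [k > n] the left side is 0. *)
Lemma binomial_pmf_min (R : realType) (n k : nat) (x : R) : 0 <= x <= 1 ->
  (1 <= k)%N -> 0 <= binomial_pmf n x k <= Num.min 1 (n%:R * x).
Proof.
move=> /andP[x0 x1] k1.
have pmf_ge0 j : 0 <= binomial_pmf n x j by rewrite binomial_pmf_ge0// x0.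
rewrite pmf_ge0/=.
have le1 : binomial_pmf n x k <= 1 - (1 - x) ^+ n.
  rewrite -binomial_pmf0 lerBrDr.
  have [kn|nk] := ltnP k n.+1; last first.
    rewrite {1}/binomial_pmf bin_small// mulr0n add0r binomial_pmf0.
    by rewrite exprn_ile1 ?subr_ge0// gerBl.
  rewrite -(sum_binomial_pmf n x) (bigD1 (Ordinal kn))//= lerD2l.
  rewrite (bigD1 ord0)//=; last by rewrite -val_eqE/= eq_sym -lt0n.
  by rewrite lerDl sumr_ge0.
apply: (le_trans le1); by apply: one_sub_expr_min; rewrite x0.
Qed.

(** The operator [x d/dx] sends [b_j] to [j b_j - (j+1) b_{j+1}], so it preserves combinations of
    the [b_j] with [j >= 1], each at most [min(1, n x)]. Applying it twice yields the constant,
    which is free of [n]. *)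
Lemma log_derivatives_binomial_pmf (R : realType) (n k : nat) : (1 <= k)%N ->
  let b j (x : R) := binomial_pmf n x j in
  let D j x := j%:R * b j x - j.+1%:R * b j.+1 x in
  log_derivatives_bounded
    (k%:R * (k%:R + k.+1%:R) + k.+1%:R * (k.+1%:R + k.+2%:R)) n%:R
    (b k) (D k) (fun x => k%:R * D k x - k.+1%:R * D k.+1 x).
Proof.
move=> k1 b D x /andP[x0 x1].
have x00 : x != 0 by rewrite gt_eqF.
have x01 : 0 <= x <= 1 by rewrite ltW.
have db j : is_derive x 1 (b j) (D j x / x).
  exact: is_derive_binomial_pmf.
set m := Num.min 1 (n%:R * x).
have bm j : (1 <= j)%N -> `|b j x| <= m.
  by move=> j1; have /andP[h1 h2] := @binomial_pmf_min R n j x x01 j1;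
    rewrite ger0_norm.
have m0 : 0 <= m by rewrite le_min ler01 mulr_ge0// ltW.
have Dm j : (1 <= j)%N -> `|D j x| <= (j%:R + j.+1%:R) * m.
  move=> j1; apply: (le_trans (ler_normB _ _)).
  by rewrite !normrM !normr_nat mulrDl lerD// ler_wpM2l// bm.
have k1R : 1 <= k%:R :> R by rewrite ler1n.
have kS i : i.+1%:R = i%:R + 1 :> R by rewrite natr1.
split; first exact: db.
  apply: is_derive_eq (is_deriveB (is_deriveZ k%:R (db k))
    (is_deriveZ k.+1%:R (db k.+1))) _.
  by rewrite /GRing.scale/=; field.
split.
- apply: (le_trans (bm _ k1)); rewrite ler_peMl// !kS; nra.
- apply: (le_trans (Dm _ k1)); rewrite ler_wpM2r// !kS; nra.
- apply: (le_trans (ler_normB _ _)).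
  rewrite !normrM !normr_nat mulrDl -!mulrA.
  by apply: lerD; rewrite ler_wpM2l// Dm.
Qed.

Lemma log_derivatives_binomial_pmf0 (R : realType) (n : nat) :
  let b j (x : R) := binomial_pmf n x j in
  log_derivatives_bounded 3 n%:R
    (fun x => 1 - b 0%N x) (b 1%N) (fun x => b 1%N x - 2 * b 2 x).
Proof.
move=> b x /andP[x0 x1].
have x00 : x != 0 by rewrite gt_eqF.
have x01 : 0 <= x <= 1 by rewrite ltW.
have db j := @is_derive_binomial_pmf R n j x x00.
set m := Num.min 1 (n%:R * x).
have bm j : (1 <= j)%N -> 0 <= b j x <= m := @binomial_pmf_min R n j x x01.
split.
- have -> : (fun x => 1 - b 0%N x) = (cst (1 : R) : R -> R) - b 0%N by [].
  apply: is_derive_eq (is_deriveB _ (db 0%N)) _.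
  by rewrite /b mul0r !sub0r mul1r mulNr opprK.
- by apply: is_derive_eq (db 1%N) _; rewrite mul1r.
have /andP[b10 b1m] := bm 1%N isT.
have /andP[b20 b2m] := bm 2 isT.
split; last 2 first.
- by rewrite ger0_norm//; lra.
- by rewrite ler_norml; lra.
have -> : `|1 - b 0%N x| = 1 - (1 - x) ^+ n.
  rewrite /b binomial_pmf0 ger0_norm// subr_ge0.
  by rewrite exprn_ile1 ?subr_ge0// gerBl ltW.
have : 1 - (1 - x) ^+ n <= m := one_sub_expr_min n x01.
by lra.
Qed.

(** * Expected occupancy counts *)

Lemma binomial_pmfS0 (R : realType) (n : nat) (x : R) :
  binomial_pmf n.+1 x 0 = binomial_pmf n x 0 * (1 - x).
Proof. by rewrite !binomial_pmf0 exprSr. Qed.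

(** Pascal's rule; it matches the split according to whether the last ball hits the urn. *)
Lemma binomial_pmfSS (R : realType) (n k : nat) (x : R) :
  binomial_pmf n.+1 x k.+1 =
  binomial_pmf n x k.+1 * (1 - x) + binomial_pmf n x k * x.
Proof.
rewrite !binomial_pmfE binS subSS natrD exprS mulrDl.
congr (_ + _); last by ring.
have [kn|nk] := ltnP k n; last by rewrite bin_small// !mul0r.
by rewrite -[in LHS](subnSK kn) exprS; ring.
Qed.

Lemma bigcap_seq_cons (T : Type) (I : eqType) (i : I) (s : seq I)
    (B : I -> set T) :
  \bigcap_(j in [set` i :: s]) B j = B i `&` \bigcap_(j in [set` s]) B j.
Proof.
apply/seteqP; split => [w h|w [Bi h] j /=].
  split; first by apply: h; rewrite /= mem_head.
  by move=> j js; apply: h; rewrite /= in_cons; apply/orP; right.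
by rewrite in_cons => /predU1P[->//|]; exact: h.
Qed.

Lemma nballsS (T : Type) (X : nat -> T -> nat) (i n : nat) (w : T) :
  nballs X i n.+1 w = (nballs X i n w + (X n w == i))%N.
Proof. by rewrite /nballs big_ord_recr. Qed.

Lemma measurable_nballs (d : measure_display) (T : measurableType d)
    (R : realType) (P : probability T R) (X : nat -> {RV P >-> nat})
    (i n k : nat) :
  measurable [set w | nballs (fun j => X j) i n w = k].
Proof.
have mX j (B : set nat) : measurable (X j @^-1` B).
  by rewrite -[X in measurable X]setTI; exact: measurable_funP.
elim: n k => [|n IH] k.
  rewrite (_ : [set w | _] = [set w | 0%N = k]); last first.
    by apply/seteqP; split => w /=; rewrite /nballs big_ord0.
  have [->|k0] := eqVneq 0%N k.
    by rewrite (_ : [set _ | _] = setT)//; apply/seteqP; split.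
  rewrite (_ : [set _ | _] = set0)//; apply/seteqP; split => // w /= /eqP.
  by rewrite (negbTE k0).
rewrite (_ : [set w | _] =
    ([set w | nballs (fun j => X j) i n w = k] `&` X n @^-1` (~` [set i])) `|`
    (if k is k'.+1 then
      [set w | nballs (fun j => X j) i n w = k'] `&` X n @^-1` [set i]
      else set0)); last first.
  apply/seteqP; split => w /=; rewrite nballsS.
    have [Xi|Xi] := eqVneq (X n w) i; last first.
      by rewrite addn0 => E; left; split => //; apply/eqP.
    by case: k => [|k]; rewrite addn1// => -[E]; right.
  move=> [[E /eqP/negbTE->]|]; first by rewrite addn0.
  by case: k => [//|k] [E ->]; rewrite eqxx addn1 E.
apply: measurableU; first exact: measurableI.
by case: k => // k; exact: measurableI.
Qed.

(** The events on the [m] balls after the first [n] make the induction on [n] close: ball [n] passes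
    from the counted block to the block where independence is stated ball by ball. *)
Lemma prob_nballs_indep (d : measure_display) (T : measurableType d)
    (R : realType) (P : probability T R) (p : nat -> R)
    (X : nat -> {RV P >-> nat}) (i n k m : nat) (B : nat -> set nat) :
  urn_scheme p X -> (1 <= i)%N ->
  P ([set w | nballs (fun j => X j) i n w = k] `&`
     \bigcap_(j in [set` iota n m]) (X j @^-1` B j)) =
  ((binomial_pmf n (p i) k)%:E * \prod_(j <- iota n m) P (X j @^-1` B j))%E.
Proof.
move=> [indX PX] i1.
have mX j (A : set nat) : measurable (X j @^-1` A).
  by rewrite -[X in measurable X]setTI; exact: measurable_funP.
have mcap (s : seq nat) (A : nat -> set nat) :
    measurable (\bigcap_(j in [set` s]) (X j @^-1` A j)).
  by apply: fin_bigcap_measurable => //; exact: finite_seq.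
have PXC j : P (X j @^-1` (~` [set i])) = (1 - p i)%:E.
  by rewrite -preimage_setC probability_setC// PX.
have p01 : 0 <= p i <= 1.
  by rewrite -!lee_fin -(PX _ 0%N i1) measure_ge0 probability_le1.
elim: n k m B => [|n IH] k m B.
  have E w : nballs (fun j => X j) i 0 w = 0%N by rewrite /nballs big_ord0.
  have [->|k0] := eqVneq k 0%N.
    rewrite binomial_pmf0 expr0 mul1e -indX ?iota_uniq//.
    by congr (P _); apply/seteqP; split => [w []|w ?]//; split.
  rewrite (_ : _ `&` _ = set0); last first.
    apply/seteqP; split => // w [] /=; rewrite E => k0'.
    by rewrite -k0' eqxx in k0.
  by rewrite measure0 /binomial_pmf bin_small ?lt0n// mulr0n mul0e.
(* The later events are kept, and [C] is prescribed for ball [n]. *)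
pose B' (C : set nat) j := if j == n then C else B j.
have B'n C : B' C n = C by rewrite /B' eqxx.
have B'E C j : j \in iota n.+1 m -> B' C j = B j.
  by rewrite mem_iota /B' => /andP[nj _]; rewrite gtn_eqF.
have prodB' C : (\prod_(j <- iota n m.+1) P (X j @^-1` B' C j) =
    P (X n @^-1` C) * \prod_(j <- iota n.+1 m) P (X j @^-1` B j))%E.
  rewrite /= big_cons B'n; congr (_ * _)%E; rewrite !big_seq.
  by apply: eq_bigr => j /(B'E C) ->.
have capB' C : \bigcap_(j in [set` iota n m.+1]) (X j @^-1` B' C j) =
    X n @^-1` C `&` \bigcap_(j in [set` iota n.+1 m]) (X j @^-1` B j).
  rewrite /= bigcap_seq_cons B'n; congr (_ `&` _).
  by apply: eq_bigcapr => j /(B'E C) ->.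
have -> : [set w | nballs (fun j => X j) i n.+1 w = k] `&`
     \bigcap_(j in [set` iota n.+1 m]) (X j @^-1` B j) =
  ([set w | nballs (fun j => X j) i n w = k] `&`
    \bigcap_(j in [set` iota n m.+1]) (X j @^-1` B' (~` [set i]) j)) `|`
  (if k is k'.+1 then
     [set w | nballs (fun j => X j) i n w = k'] `&`
    \bigcap_(j in [set` iota n m.+1]) (X j @^-1` B' [set i] j) else set0).
  rewrite !capB'; apply/seteqP; split => w.
    move=> [/=]; rewrite nballsS.
    have [Xi|Xi] := eqVneq (X n w) i; last first.
      by rewrite addn0 => E h; left; split => //; split => //; apply/eqP.
    by case: k => [|k]; rewrite addn1// => -[E] h; right.
  move=> [[/= E [Xi h]]|].
    split => //=; rewrite nballsS E.
    by move/eqP/negbTE : Xi => ->; rewrite addn0.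
  case: k => [//|k] [/= E [Xi h]]; split => //=.
  by rewrite nballsS E Xi eqxx addn1.
have mI l C : measurable ([set w | nballs (fun j => X j) i n w = l] `&`
    \bigcap_(j in [set` iota n m.+1]) (X j @^-1` B' C j)).
  by apply: measurableI => //; exact: measurable_nballs.
case: k => [|k].
  rewrite setU0 (IH 0%N m.+1 (B' (~` [set i]))) prodB' PXC muleA -EFinM.
  by rewrite binomial_pmfS0.
have PU (U V : set T) : measurable U -> measurable V -> U `&` V = set0 ->
    P (U `|` V) = (P U + P V)%E by exact: measureU.
rewrite PU//; last first.
  rewrite !capB'; apply/seteqP; split => // w [[_ [Xi _]] [_ [Xi' _]]].
  exact: Xi.
rewrite (IH k.+1 m.+1 (B' (~` [set i]))) (IH k m.+1 (B' [set i])).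
rewrite !prodB' PXC PX// !muleA -!EFinM -ge0_muleDl.
- by rewrite -EFinD -binomial_pmfSS.
- by rewrite lee_fin mulr_ge0 ?binomial_pmf_ge0// subr_ge0; case/andP: p01.
- by rewrite lee_fin mulr_ge0 ?binomial_pmf_ge0//; case/andP: p01.
Qed.

Lemma prob_nballs (d : measure_display) (T : measurableType d)
    (R : realType) (P : probability T R) (p : nat -> R)
    (X : nat -> {RV P >-> nat}) (i n k : nat) :
  urn_scheme p X -> (1 <= i)%N ->
  P [set w | nballs (fun j => X j) i n w = k] = (binomial_pmf n (p i) k)%:E.
Proof.
move=> hX i1.
have := @prob_nballs_indep _ _ _ _ p X i n k 0 (fun=> setT) hX i1.
rewrite big_nil mule1 => <-; congr (P _).
by apply/seteqP; split => [w h|w []//]; split.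
Qed.

(** Expectation and series of indicators are exchanged by nonnegativity. Both uses of [fine] are
    harmless: pointwise the series is a finite sum, and the expectation is at most [C]. *)
Lemma cvg_expectation_count (d : measure_display) (T : measurableType d)
    (R : realType) (P : probability T R) (Z : nat -> T -> bool)
    (u : nat -> R) (C : R) :
  (forall i, measurable [set w | Z i w]) ->
  (forall w, exists m, forall i, (m <= i)%N -> Z i w = false) ->
  (forall i, (1 <= i)%N -> P [set w | Z i w] = (u i)%:E) ->
  (forall M, \sum_(1 <= i < M) u i <= C) ->
  \sum_(1 <= i < M) u i @[M --> \oo] -->
    fine ('E_P[fun w => fine (\sum_(1 <= i <oo) ((Z i w)%:R)%:E)%E])%E.
Proof.
move=> mZ Z0 PZ uC.
have fineZ w : (fine (\sum_(1 <= i <oo) ((Z i w)%:R)%:E)%E)%:E =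
    (\sum_(1 <= i <oo) ((Z i w)%:R)%:E)%E :> \bar R.
  have [m mP] := Z0 w.
  rewrite fineK// (@lim_near_cst _ _ _ _ _
    (\sum_(1 <= i < m.+1) ((Z i w)%:R)%:E)%E) //.
    by rewrite sumEFin.
  near=> M; have mM : (m < M)%N by near: M; exact: nbhs_infty_gt.
  rewrite (@big_cat_nat _ _ _ m.+1 1 M)//= [X in (_ + X)%E]big1_seq ?adde0//.
  by move=> i; rewrite mem_index_iota => /andP[_ /andP[/ltnW/mP -> _]].
have u0 i : (1 <= i)%N -> 0 <= u i by move=> i1; rewrite -lee_fin -PZ.
have -> : ('E_P[fun w => fine (\sum_(1 <= i <oo) ((Z i w)%:R)%:E)%E] =
    \sum_(1 <= i <oo) (u i)%:E)%E.
  rewrite unlock; under eq_integral do rewrite fineZ.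
  under eq_integral do rewrite -nneseries_addn//.
  rewrite integral_nneseries//; last first.
    move=> n; apply/measurable_realfun.measurable_EFinP.
    rewrite (_ : (fun w => _) = \1_[set w | Z (n + 1)%N w]).
      exact: measurable_realfun.measurable_indic.
    by apply/funext => w; rewrite indicE mem_setE.
  rewrite [RHS](_ : _ = (\sum_(1 <= i <oo) P [set w | Z i w])%E); last first.
    apply: congr_lim; apply/funext => M; rewrite !big_nat.
    by apply: eq_bigr => i /andP[/PZ].
  rewrite -(@nneseries_addn _ (fun i => P [set w | Z i w]))//.
  apply: eq_eseriesr => i _.
  rewrite (_ : (fun w => _) = (fun w => (\1_[set w | Z (i + 1)%N w] w)%:E)).
    by rewrite integral_indic// setIT.
  by apply/funext => w; rewrite indicE mem_setE.
have cv : cvgn (fun M => (\sum_(1 <= i < M) (u i)%:E)%E).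
  by apply: is_cvg_nneseries => i i1 _; rewrite lee_fin u0.
have Lfin : (\sum_(1 <= i <oo) (u i)%:E)%E \is a fin_num.
  rewrite ge0_fin_numE; last first.
    by apply: nneseries_ge0 => i i1 _; rewrite lee_fin u0.
  apply: (@le_lt_trans _ _ C%:E); last exact: ltry.
  by apply: lime_le => //; near=> M; rewrite sumEFin lee_fin.
rewrite (_ : (fun M => _) = fine \o (fun M => (\sum_(1 <= i < M) (u i)%:E)%E)).
  by apply: fine_cvg; rewrite fineK.
by apply/funext => M /=; rewrite sumEFin.
Unshelve. all: by end_near.
Qed.

Lemma nballs_eventually0 (T : Type) (X : nat -> T -> nat) (n : nat) (w : T) :
  exists m, forall i, (m <= i)%N -> nballs X i n w = 0%N.
Proof.
(* The sum of the labels hit is at least each single label. *)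
exists (\sum_(j < n) X j w).+1 => i mi; rewrite /nballs big1// => j _.
apply/eqP; rewrite eqb0; apply/eqP => Xi; move: mi.
by rewrite -Xi (bigD1 j)//= ltnNge leq_addr.
Qed.

Lemma sum_le_balls (R : realType) (p u : nat -> R) (n M : nat) :
  urn_probabilities p -> (forall i, (1 <= i)%N -> u i <= n%:R * p i) ->
  \sum_(1 <= i < M) u i <= n%:R.
Proof.
move=> hp up; apply: (@le_trans _ _ (n%:R * \sum_(1 <= i < M) p i)).
  by rewrite mulr_sumr !big_nat; apply: ler_sum => i /andP[/up].
by rewrite ler_piMr// sum_urn_probabilities_le1.
Qed.

Lemma urn_probability_itv (R : realType) (p : nat -> R) (i : nat) :
  urn_probabilities p -> (1 <= i)%N -> 0 <= p i <= 1.
Proof.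
by move=> hp i1; rewrite urn_probability_le1// andbT; case: hp => /(_ i i1)/ltW.
Qed.

Lemma cvg_expectation_urns_with (R : realType) (p : nat -> R)
    (d : measure_display) (T : measurableType d) (P : probability T R)
    (X : nat -> {RV P >-> nat}) (n k : nat) :
  urn_probabilities p -> urn_scheme p X -> (1 <= k)%N ->
  \sum_(1 <= i < M) binomial_pmf n (p i) k @[M --> \oo] -->
    fine ('E_P[urns_with R (fun j => X j) n k])%E.
Proof.
move=> hp hX k1.
have setE i : [set w | nballs (fun j => X j) i n w == k] =
    [set w | nballs (fun j => X j) i n w = k].
  by apply/seteqP; split => w /eqP.
apply: (@cvg_expectation_count _ _ _ P
  (fun i w => nballs (fun j => X j) i n w == k) _ n%:R).
- by move=> i; rewrite setE; exact: measurable_nballs.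
- move=> w; have [m mP] := nballs_eventually0 (fun j => X j) n w.
  by exists m => i /mP ->; rewrite ltn_eqF.
- by move=> i i1; rewrite setE; exact: prob_nballs.
move=> M; apply: (sum_le_balls _ hp) => i i1.
have /andP[_] := binomial_pmf_min n (urn_probability_itv hp i1) k1.
by rewrite le_min => /andP[].
Qed.

Lemma cvg_expectation_nonempty_urns (R : realType) (p : nat -> R)
    (d : measure_display) (T : measurableType d) (P : probability T R)
    (X : nat -> {RV P >-> nat}) (n : nat) :
  urn_probabilities p -> urn_scheme p X ->
  \sum_(1 <= i < M) (1 - binomial_pmf n (p i) 0) @[M --> \oo] -->
    fine ('E_P[nonempty_urns R (fun j => X j) n])%E.
Proof.
move=> hp hX.
have setE i : [set w | 0 < nballs (fun j => X j) i n w]%N =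
    ~` [set w | nballs (fun j => X j) i n w = 0%N].
  by apply/seteqP; split => w /=; rewrite lt0n => /eqP.
apply: (@cvg_expectation_count _ _ _ P
  (fun i w => 0 < nballs (fun j => X j) i n w)%N _ n%:R).
- by move=> i; rewrite setE; apply: measurableC; exact: measurable_nballs.
- move=> w; have [m mP] := nballs_eventually0 (fun j => X j) n w.
  by exists m => i /mP ->.
- move=> i i1; rewrite setE probability_setC; last exact: measurable_nballs.
  by rewrite (prob_nballs n 0 hX i1).
move=> M; apply: (sum_le_balls _ hp) => i i1.
have := one_sub_expr_min n (urn_probability_itv hp i1).
by rewrite binomial_pmf0 le_min => /andP[].
Qed.

Theorem corollary2 (R : realType) (theta c : R) (p : nat -> R)
    (d : measure_display) (T : measurableType d) (P : probability T R)
    (X : nat -> {RV P >-> nat})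
    (theta0 : 0 < theta) (theta1 : theta < 1) (c0 : 0 < c)
    (hp : urn_probabilities p) (hX : urn_scheme p X)
    (hasym : exists2 eps : nat -> R,
       eps =o_\oo (fun i : nat => i%:R `^ (- (1 / 2))) &
       forall i : nat, (1 <= i)%N ->
         p i = c * i%:R `^ (- (1 / theta)) * (1 + eps i)) :
  ((fun n : nat =>
      (fine ('E_P[urns_with R X n 1])%E -
       theta * fine ('E_P[nonempty_urns R X n])%E)
      / Num.sqrt (alpha p n%:R)%:R) @ \oo --> (0 : R)) /\
  (forall k : nat, (1 <= k)%N ->
    (fun n : nat =>
      ((k%:R - theta) * fine ('E_P[urns_with R X n k])%E -
       k.+1%:R * fine ('E_P[urns_with R X n k.+1])%E)
      / Num.sqrt (alpha p n%:R)%:R) @ \oo --> (0 : R)).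
Proof.
case: hasym => eps epso; rewrite div1r => pE; 
pose b (n j : nat) (x : R) := binomial_pmf n x j.
split => [|k k1].
  (* With [F = 1 - b_0] one has [x F' = b_1], so [D - theta F] sums to [E R_{n,1} - theta E R_n]. *)
  apply: (@cvg_series_over_sqrt_alpha _ _ _ 3 _ _ (fun n x => 1 - b n 0 x)
    (b ^~ 1) (fun n x => b n 1 x - 2 * b n 2 x) _ theta0 theta1 c0 _ hp epso pE
    (@log_derivatives_binomial_pmf0 R)) => // n.
  under eq_fun do rewrite sumrB -mulr_sumr.
  apply: cvgB; first exact: cvg_expectation_urns_with.
  by apply: cvgMl_tmp; exact: cvg_expectation_nonempty_urns.
(* With [F = b_k], [D - theta F] is [(k - theta) b_k - (k+1) b_{k+1}]. *)
pose D n j x : R := j%:R * b n j x - j.+1%:R * b n j.+1 x.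
apply: (@cvg_series_over_sqrt_alpha _ _ _ _ _ _ (b ^~ k) (D ^~ k)
  (fun n x => k%:R * D n k x - k.+1%:R * D n k.+1 x) _ theta0 theta1 c0 _ hp
  epso pE (fun n => @log_derivatives_binomial_pmf R n k k1)).
  by rewrite -!natrD -!natrM -natrD.
move=> n.
rewrite (_ : (fun M => _) = (fun M =>
    (k%:R - theta) * \sum_(1 <= i < M) b n k (p i) -
    k.+1%:R * \sum_(1 <= i < M) b n k.+1 (p i))).
  by apply: cvgB; apply: cvgMl_tmp; exact: cvg_expectation_urns_with.
apply/funext => M; rewrite !mulr_sumr -sumrB; apply: eq_bigr => i _.
by rewrite mulrBl addrAC.
Qed.
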